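(* For a general value of $p$ (that is, for all but finitely many $p\in\mathbf C$), the group $\Theta=\Theta(p)$ is generated by the six elements $$(x\;x')\,(y\;y')\,(z\;z'),\qquad \{x,y,z\}=\{\mathbb A,\mathbb B,\mathbb C\},\quad \{x',y',z'\}=\{\mathbb D,\mathbb E,\mathbb F\}.$$
   Context: The cross-ratio of four ordered points of $\mathbf P^1=\mathbf C\cup\{\infty\}$ is $\langle z_1,z_2,z_3,z_4\rangle=\frac{(z_1-z_3)(z_2-z_4)}{(z_1-z_4)(z_2-z_3)}$. Let $\mathrm{LTR}=\{\mathbb A,\mathbb B,\mathbb C,\mathbb D,\mathbb E,\mathbb F\}$ be a set of six letters. For $p\in\mathbf C$ with $p\neq 0,1,\frac{1\pm\sqrt{-3}}{2}$, let $h:\mathrm{LTR}\to\mathbf P^1$ be the injective map $$\mathbb A\mapsto 0,\quad \mathbb B\mapsto 1,\quad \mathbb C\mapsto\infty,\quad \mathbb D\mapsto p,\quad \mathbb E\mapsto\tfrac{p-1}{p},\quad \mathbb F\mapsto\tfrac{1}{1-p}.$$ $\Theta(p)$ denotes the group of bijections $\eta:\mathrm{LTR}\to\mathrm{LTR}$ such that, writing $A'=h(\eta(\mathbb A))$, $B'=h(\eta(\mathbb B))$, and so on, $$\langle A',B',C',F'\rangle=\langle B',C',A',E'\rangle=\langle C',A',B',D'\rangle .$$ For a general value of $p$ this subgroup of the permutation group of $\mathrm{LTR}$ does not depend on $p$, and it is denoted $\Theta$. The elements in the claim are products of three disjoint transpositions of letters. *)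

(* Defs.v *)
From HB Require Import structures.
From mathcomp Require Import all_boot all_order all_algebra all_fingroup.
From mathcomp Require Import reals complex.
Set Implicit Arguments.
Unset Strict Implicit.
Unset Printing Implicit Defensive.
Import Order.TTheory GRing.Theory Num.Theory.
Local Open Scope ring_scope.

Inductive LTR : Type := lA | lB | lC | lD | lE | lF.

Definition LTR_index (x : LTR) : 'I_6 :=
  match x with
  | lA => inord 0 | lB => inord 1 | lC => inord 2
  | lD => inord 3 | lE => inord 4 | lF => inord 5
  end.

Definition LTR_of_index (i : 'I_6) : LTR := nth lA [:: lA; lB; lC; lD; lE; lF] i.

Lemma LTR_indexK : cancel LTR_index LTR_of_index.
Proof. by case; rewrite /LTR_of_index /= inordK. Qed.

HB.instance Definition _ := Finite.copy LTR (can_type LTR_indexK).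

(* P^1 = C \cup {oo}, with C = R[i]; None is the point at infinity. *)
Definition P1 (R : realType) : Type := option R[i].

(* Homogeneous coordinates: z = [z : 1] and oo = [1 : 0]. *)
Definition hcoord (R : realType) (z : P1 R) : R[i] * R[i] :=
  if z is Some x then (x, 1) else (1, 0).

(* This is z - w when z and w are both finite. *)
Definition bracket (R : realType) (z w : P1 R) : R[i] :=
  (hcoord z).1 * (hcoord w).2 - (hcoord w).1 * (hcoord z).2.

(* The value is in C because the cross-ratio of four distinct points is finite.
   When two points coincide it may be a junk value (x / 0 = 0); this does not
   happen in Theta p for admissible p, since h p is then injective. *)
Definition cross_ratio (R : realType) (z1 z2 z3 z4 : P1 R) : R[i] :=
  (bracket z1 z3 * bracket z2 z4) / (bracket z1 z4 * bracket z2 z3).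

Lemma cross_ratio_finite (R : realType) (z1 z2 z3 z4 : R[i]) :
  cross_ratio (Some z1) (Some z2) (Some z3) (Some z4) =
  ((z1 - z3) * (z2 - z4)) / ((z1 - z4) * (z2 - z3)).
Proof. by rewrite /cross_ratio /bracket /= !mulr1. Qed.

Lemma cross_ratio_oo1 (R : realType) (z2 z3 z4 : R[i]) :
  cross_ratio None (Some z2) (Some z3) (Some z4) = (z2 - z4) / (z2 - z3).
Proof. by rewrite /cross_ratio /bracket /= !mulr1 !mulr0 !subr0 !mul1r. Qed.

Lemma cross_ratio_oo2 (R : realType) (z1 z3 z4 : R[i]) :
  cross_ratio (Some z1) None (Some z3) (Some z4) = (z1 - z3) / (z1 - z4).
Proof. by rewrite /cross_ratio /bracket /= !mulr1 !mulr0 !subr0 !mulr1. Qed.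

Lemma cross_ratio_oo3 (R : realType) (z1 z2 z4 : R[i]) :
  cross_ratio (Some z1) (Some z2) None (Some z4) = (z2 - z4) / (z1 - z4).
Proof.
by rewrite /cross_ratio /bracket /= !mulr1 !mulr0 !sub0r mulrN1 mulN1r invrN mulrNN.
Qed.

Lemma cross_ratio_oo4 (R : realType) (z1 z2 z3 : R[i]) :
  cross_ratio (Some z1) (Some z2) (Some z3) None = (z1 - z3) / (z2 - z3).
Proof.
by rewrite /cross_ratio /bracket /= !mulr1 !mulr0 !sub0r mulrN1 mulN1r invrN mulrNN.
Qed.

Definition admissible (R : realType) (p : R[i]) : bool :=
  [&& p != 0, p != 1, p != (1 + sqrtC (- 3)) / 2 & p != (1 - sqrtC (- 3)) / 2].

Definition h (R : realType) (p : R[i]) (x : LTR) : P1 R :=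
  match x with
  | lA => Some 0
  | lB => Some 1
  | lC => None
  | lD => Some p
  | lE => Some ((p - 1) / p)
  | lF => Some (1 / (1 - p))
  end.

Definition Theta (R : realType) (p : R[i]) : {set {perm LTR}} :=
  [set eta : {perm LTR} |
    let A' := h p (eta lA) in let B' := h p (eta lB) in
    let C' := h p (eta lC) in let D' := h p (eta lD) in
    let E' := h p (eta lE) in let F' := h p (eta lF) in
    (cross_ratio A' B' C' F' == cross_ratio B' C' A' E') &&
    (cross_ratio B' C' A' E' == cross_ratio C' A' B' D')].

Definition Theta_generators : {set {perm LTR}} :=
  [set s | [exists x : LTR, exists y : LTR, exists z : LTR,
            exists x' : LTR, exists y' : LTR, exists z' : LTR,
     [&& [set x; y; z] == [set lA; lB; lC],
         [set x'; y'; z'] == [set lD; lE; lF] &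
         s == (tperm x x' * tperm y y' * tperm z z')%g]]].

(* Main.v *)
Require Import Defs.
From HB Require Import structures.
From mathcomp Require Import all_boot all_order all_algebra all_fingroup.
From mathcomp Require Import reals complex.
From mathcomp Require Import ring.
Set Implicit Arguments.
Unset Strict Implicit.
Unset Printing Implicit Defensive.
Import Order.TTheory GRing.Theory Num.Theory.
Local Open Scope ring_scope.

(** The homography phi : z |-> 1 / (1 - z) has order 3; it cycles 0, 1, oo and
cycles p, 1 / (1 - p), (p - 1) / p.  On letters it is the permutation
c = (A B C)(F E D), called [turn] below.  The three cross-ratios that define
Theta p are obtained from each other by applying c to the letters, so their
equality says that the relabelled six points are still permuted by c through
some homography of order 3.  This suggests the actual answer: for general p,
Theta p is the normaliser of the cyclic group generated by c.

That the normaliser lies in Theta p holds as soon as h is defined, p <> 0, 1: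
if eta commutes with c, or conjugates it to its inverse, then turning the
arguments of a cross-ratio of the points h (eta _) amounts to applying phi or
phi^2 to these points, which leaves the cross-ratio unchanged
([norm_sub_Theta]).

For the opposite inclusion, clear denominators.  The two equations that put eta
in Theta p become polynomial equations in p with integer coefficients.  At the
integer point 2 they have no solution outside the normaliser, by inspection of
the 720 permutations ([locus2_norm]).  Hence for each eta outside the
normaliser one of the two polynomials is non-zero and has finitely many roots;
these roots, over all eta, are the exceptions, together with the p at which two
of the six points collide ([avoid_roots]).

Finally, the normaliser is generated by the six triple transpositions.  Each of
them normalises c by inspection ([swap_in_norm]).  Conversely, products of two
of them give double transpositions (x y)(x' y') ([double_tperm_gen]); with
these, an element of the normaliser is moved until it fixes A and D, which
leaves only the identity and (B C)(E F) ([norm_sub_generators]). *)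

(** * Finite checks over the letters *)

(** Equality on letters is defined through an enumeration that does not reduce;
comparing these codes does, which is what makes exhaustive checks run. *)
Definition code (x : LTR) : nat :=
  match x with lA => 0 | lB => 1 | lC => 2 | lD => 3 | lE => 4 | lF => 5 end.

Lemma code_inj : injective code.
Proof. by case; case. Qed.

Lemma LTR_eqE (x y : LTR) : (x == y) = (code x == code y)%N.
Proof. by rewrite (inj_eq code_inj). Qed.

Definition letters : seq LTR := [:: lA; lB; lC; lD; lE; lF].

Lemma all_letters (P : pred LTR) : reflect (forall x, P x) (all P letters).
Proof.
apply: (iffP idP) => [/and5P[? ? ? ? /and3P[? ? _]] [] // | P_all].
by apply/allP => x _.
Qed.

Lemma all6_letters (P : LTR -> LTR -> LTR -> LTR -> LTR -> LTR -> bool) :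
  all (fun a => all (fun b => all (fun c => all (fun d => all (fun e =>
    all (P a b c d e) letters) letters) letters) letters) letters) letters ->
  forall a b c d e f, P a b c d e f.
Proof.
move=> + a b c d e f => /all_letters/(_ a)/all_letters/(_ b)/all_letters/(_ c).
by move=> /all_letters/(_ d)/all_letters/(_ e)/all_letters/(_ f).
Qed.

(** * The permutation of order 3 and its normaliser *)

(** The action on the letters of the homography z |-> 1 / (1 - z). *)
Definition turn (x : LTR) : LTR :=
  match x with
  | lA => lB | lB => lC | lC => lA
  | lF => lE | lE => lD | lD => lF
  end.

Lemma turn3 (x : LTR) : turn (turn (turn x)) = x.
Proof. by case: x. Qed.

Lemma turn_inj : injective turn.
Proof. by apply: (can_inj (g := turn \o turn)) => x; exact: turn3. Qed.

Definition turnp : {perm LTR} := perm turn_inj.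

Definition commutes_turn (eta : LTR -> LTR) : bool :=
  all (fun x => code (eta (turn x)) == code (turn (eta x)))%N letters.

Definition reverses_turn (eta : LTR -> LTR) : bool :=
  all (fun x => code (eta (turn x)) == code (turn (turn (eta x))))%N letters.

Lemma commutes_turnP (eta : LTR -> LTR) :
  reflect (forall x, eta (turn x) = turn (eta x)) (commutes_turn eta).
Proof. by apply: (iffP (all_letters _)) => E x; [apply/code_inj/eqP | rewrite E]. Qed.

Lemma reverses_turnP (eta : LTR -> LTR) :
  reflect (forall x, eta (turn x) = turn (turn (eta x))) (reverses_turn eta).
Proof. by apply: (iffP (all_letters _)) => E x; [apply/code_inj/eqP | rewrite E]. Qed.

(** As c has order 3, the conjugate of c by an element of the normaliser is c or
c^2 = c^-1; the power c^0 is excluded because c is not the identity. *)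
Lemma norm_turnE (eta : {perm LTR}) :
  (eta \in 'N(<[turnp]>))%g = commutes_turn eta || reverses_turn eta.
Proof.
rewrite inE -cycleJ cycle_subG; apply/idP/orP => [/cycleP[i Ei]|].
  have turn_conj x : eta (turn x) = (turnp ^+ i)%g (eta x).
    by rewrite -Ei permJ permE.
  have turnpX3 : (turnp ^+ 3 = 1)%g
    by apply/permP => x; rewrite !expgS expg0 mulg1 perm1 !permM !permE turn3.
  move: turn_conj; rewrite -(expg_mod i turnpX3).
  have: (i %% 3 < 3)%N by rewrite ltn_mod.
  case: (i %% 3)%N => [|[|[|//]]] _ turn_conj.
  - by have := turn_conj lA; rewrite perm1 => /perm_inj.
  - by left; apply/commutes_turnP => x; rewrite turn_conj expg1 permE.
  - right; apply/reverses_turnP => x.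
    by rewrite turn_conj expgS expg1 permM !permE.
case=> [/commutes_turnP | /reverses_turnP] E.
  rewrite (_ : turnp ^ eta = turnp)%g ?cycle_id //.
  by apply/permP => x; rewrite -(permKV eta x) permJ !permE E.
rewrite (_ : turnp ^ eta = turnp^-1)%g ?groupV ?cycle_id //.
apply/permP => x; rewrite -(permKV eta x) permJ permE.
by apply: (@perm_inj _ turnp); rewrite permKV !permE E turn3.
Qed.

(** * The normaliser is generated by the triple transpositions *)

Definition ABC_triple (x y z : LTR) : bool :=
  [&& code x < 3, code y < 3, code z < 3 & uniq [:: code x; code y; code z]]%N.

Definition DEF_triple (x y z : LTR) : bool :=
  [&& 2 < code x, 2 < code y, 2 < code z & uniq [:: code x; code y; code z]]%N.

Lemma ABC_tripleE (x y z : LTR) :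
  ([set x; y; z] == [set lA; lB; lC]) = ABC_triple x y z.
Proof.
apply/eqP/idP => [/setP E | ].
  move: (E lA) (E lB) (E lC); rewrite !inE !LTR_eqE.
  by move: x y z {E} => [] [] [].
by move: x y z => [] [] [] // _; apply/setP => x; rewrite !inE !LTR_eqE; case: x.
Qed.

Lemma DEF_tripleE (x y z : LTR) :
  ([set x; y; z] == [set lD; lE; lF]) = DEF_triple x y z.
Proof.
apply/eqP/idP => [/setP E | ].
  move: (E lD) (E lE) (E lF); rewrite !inE !LTR_eqE.
  by move: x y z {E} => [] [] [].
by move: x y z => [] [] [] // _; apply/setP => x; rewrite !inE !LTR_eqE; case: x.
Qed.

Lemma Theta_generatorsP (s : {perm LTR}) :
  reflect (exists x y z x' y' z', [/\ ABC_triple x y z, DEF_triple x' y' z' &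
             s = (tperm x x' * tperm y y' * tperm z z')%g])
          (s \in Theta_generators).
Proof.
apply: (iffP idP).
  rewrite inE => /existsP[x /existsP[y /existsP[z]]].
  move=> /existsP[x' /existsP[y' /existsP[z' /and3P[xyz xyz' /eqP->]]]].
  by exists x, y, z, x', y', z'; rewrite -ABC_tripleE -DEF_tripleE.
move=> [x [y [z [x' [y' [z' [xyz xyz' ->]]]]]]]; rewrite inE.
apply/existsP; exists x; apply/existsP; exists y; apply/existsP; exists z.
apply/existsP; exists x'; apply/existsP; exists y'; apply/existsP; exists z'.
by rewrite ABC_tripleE DEF_tripleE xyz xyz' eqxx.
Qed.

(** A form of [tperm] that computes. *)
Definition transp (x y z : LTR) : LTR :=
  if code z == code x then y else if code z == code y then x else z.

Lemma tperm_transp (x y : LTR) : tperm x y =1 transp x y.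
Proof. by move=> z; rewrite permE /= !LTR_eqE. Qed.

(** The product exchanges the two cycles of c; whether it matches their
orientations depends on the parity of x |-> x', so both cases of the
normaliser occur. *)
Lemma swap_in_norm (x y z x' y' z' : LTR) :
  ABC_triple x y z -> DEF_triple x' y' z' ->
  (tperm x x' * tperm y y' * tperm z z' \in 'N(<[turnp]>))%g.
Proof.
move=> xyz xyz'.
have check : forall x y z x' y' z',
    if ABC_triple x y z && DEF_triple x' y' z' then
      let s u := transp z z' (transp y y' (transp x x' u)) in
      commutes_turn s || reverses_turn s
    else true.
  by apply: all6_letters; vm_compute.
move: (check x y z x' y' z'); rewrite xyz xyz' norm_turnE.
by rewrite /commutes_turn /reverses_turn /= !permM !tperm_transp.
Qed.

(** The two generators that send x, y, z to x', y', z' and to y', x', z' agree on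
z and z', so in their product only x, y and x', y' move. *)
Lemma double_tperm_gen (x y z x' y' z' : LTR) :
  ABC_triple x y z -> DEF_triple x' y' z' ->
  (tperm x y * tperm x' y' \in <<Theta_generators>>)%g.
Proof.
move=> xyz xyz'.
have check : forall x y z x' y' z',
    if ABC_triple x y z && DEF_triple x' y' z' then
      all (fun u => code (transp x' y' (transp x y u)) ==
        code (transp z z' (transp y x' (transp x y'
               (transp z z' (transp y y' (transp x x' u)))))))%N letters
      && DEF_triple y' x' z'
    else true.
  by apply: all6_letters; vm_compute.
move: (check x y z x' y' z'); rewrite xyz xyz' => /andP[/all_letters E xyz''].
have -> : (tperm x y * tperm x' y' =
    (tperm x x' * tperm y y' * tperm z z') *
    (tperm x y' * tperm y x' * tperm z z'))%g.
  by apply/permP => u; rewrite !permM !tperm_transp; apply/code_inj/eqP.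
apply: groupM; apply: mem_gen; apply/Theta_generatorsP.
  by exists x, y, z, x', y', z'.
by exists x, y, z, y', x', z'.
Qed.

Lemma generators_sub_norm :
  (<<Theta_generators>> \subset 'N(<[turnp]>))%g.
Proof.
rewrite gen_subG; apply/subsetP => s.
by case/Theta_generatorsP=> x [y [z [x' [y' [z' [xyz xyz' ->]]]]]]; exact: swap_in_norm.
Qed.

(** Once eta fixes A and D, its value on the other letters is determined by
whether it preserves or reverses the orientation of the cycles of c.  A letter
eta A or eta D that is not yet in place is brought there by an element of the
generated group, which does not leave the normaliser. *)
Lemma norm_sub_generators :
  ('N(<[turnp]>) \subset <<Theta_generators>>)%g.
Proof.
pose N := 'N(<[turnp]>)%g; pose G := <<Theta_generators>>%g.
have GN g : g \in G -> g \in N by move/(subsetP generators_sub_norm).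
have fixAD (eta : {perm LTR}) : eta \in N -> eta lA = lA -> eta lD = lD -> eta \in G.
  rewrite norm_turnE => + eA eD => /orP[/commutes_turnP | /reverses_turnP] E.
    suff -> : eta = 1%g by exact: group1.
    have [eB eF] : eta lB = lB /\ eta lF = lF by rewrite (E lA) (E lD) eA eD.
    have [eC eE] : eta lC = lC /\ eta lE = lE by rewrite (E lB) (E lF) eB eF.
    by apply/permP => x; rewrite perm1; case: x.
  have [eB eF] : eta lB = lC /\ eta lF = lE by rewrite (E lA) (E lD) eA eD.
  have [eC eE] : eta lC = lB /\ eta lE = lF by rewrite (E lB) (E lF) eB eF.
  suff -> : eta = (tperm lB lC * tperm lE lF)%g.
    exact: (@double_tperm_gen _ _ lA _ _ lD).
  by apply/permP => x; rewrite permM !tperm_transp; case: x.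
have step g (eta : {perm LTR}) : g \in G -> eta \in N ->
    ((eta * g)%g \in N -> (eta * g)%g \in G) -> eta \in G.
  by move=> gG etaN Gg; rewrite -(groupMr eta gG) Gg // groupM // GN.
have fixA (eta : {perm LTR}) : eta \in N -> eta lA = lA -> eta \in G.
  move=> etaN eA.
  have neD x : eta x != eta lD = (code x != 3)%N by rewrite (inj_eq perm_inj) LTR_eqE.
  have eBC : eta lB = lB /\ eta lC = lC \/ eta lB = lC /\ eta lC = lB.
    move: etaN; rewrite norm_turnE => /orP[/commutes_turnP | /reverses_turnP] E.
      by left; rewrite (E lB) (E lA) eA.
    by right; rewrite (E lB) (E lA) eA.
  (* A, B and C are already values of eta on A, B and C, so eta D is D, E or F;
     in the last two cases (B C)(D eta D) puts D in place without moving A. *)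
  move: (neD lA) (neD lB) (neD lC); rewrite !LTR_eqE /= eA.
  case eD: (eta lD) => nA nB nC.
  - by [].
  - by case: eBC nB nC => -[-> ->].
  - by case: eBC nB nC => -[-> ->].
  - exact: fixAD.
  - apply: (step _ _ (@double_tperm_gen lB lC lA lD lE lF isT isT)) => // gN.
    by apply: fixAD => //; rewrite !permM !tperm_transp ?eA ?eD.
  - apply: (step _ _ (@double_tperm_gen lB lC lA lD lF lE isT isT)) => // gN.
    by apply: fixAD => //; rewrite !permM !tperm_transp ?eA ?eD.
have genG x y z x' y' z' : ABC_triple x y z -> DEF_triple x' y' z' ->
    (tperm x x' * tperm y y' * tperm z z' \in G)%g.
  move=> xyz xyz'; apply: mem_gen; apply/Theta_generatorsP.
  by exists x, y, z, x', y', z'.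
apply/subsetP => eta etaN; case eA: (eta lA).
- exact: fixA.
- apply: (step _ _ (@double_tperm_gen lA lB lC lE lF lD isT isT)) => // gN.
  by apply: fixA => //; rewrite !permM !tperm_transp eA.
- apply: (step _ _ (@double_tperm_gen lA lC lB lE lF lD isT isT)) => // gN.
  by apply: fixA => //; rewrite !permM !tperm_transp eA.
- apply: (step _ _ (genG lA lB lC lD lE lF isT isT)) => // gN.
  by apply: fixA => //; rewrite !permM !tperm_transp eA.
- apply: (step _ _ (genG lA lB lC lE lD lF isT isT)) => // gN.
  by apply: fixA => //; rewrite !permM !tperm_transp eA.
- apply: (step _ _ (genG lA lB lC lF lD lE isT isT)) => // gN.
  by apply: fixA => //; rewrite !permM !tperm_transp eA.
Qed.

(** * Cross-ratios of the six points in homogeneous coordinates *)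

(** Denominator-free homogeneous coordinates of the points h t x.  They make
sense over any ring, so that the same formulas can be read over C, over
polynomials and over the integers. *)
Definition coord (S : comNzRingType) (t : S) (x : LTR) : S * S :=
  match x with
  | lA => (0, 1) | lB => (1, 1) | lC => (1, 0)
  | lD => (t, 1) | lE => (t - 1, t) | lF => (1, 1 - t)
  end.

Definition br (S : comNzRingType) (t : S) (x y : LTR) : S :=
  (coord t x).1 * (coord t y).2 - (coord t y).1 * (coord t x).2.

Definition cr_num (S : comNzRingType) (g : LTR -> LTR -> S) (a b c d : LTR) : S :=
  g a c * g b d.

Definition cr_den (S : comNzRingType) (g : LTR -> LTR -> S) (a b c d : LTR) : S :=
  g a d * g b c.

Lemma rmorph_br (S T : comNzRingType) (f : {rmorphism S -> T}) (t : S) (x y : LTR) :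
  f (br t x y) = br (f t) x y.
Proof.
have fc z : (f (coord t z).1 = (coord (f t) z).1) * (f (coord t z).2 = (coord (f t) z).2).
  by case: z; rewrite /= ?rmorphB ?rmorph0 ?rmorph1.
by rewrite /br rmorphB !rmorphM !fc.
Qed.

(** Each point occurs once in the numerator and once in the denominator of the
cross-ratio, so the scaling factors cancel. *)
Lemma cross_ratio_scale (F : fieldType) (g g' : LTR -> LTR -> F) (w : LTR -> F) :
  (forall x, w x != 0) -> (forall x y, g x y = w x * w y * g' x y) ->
  forall a b c d, cr_num g a b c d / cr_den g a b c d
                = cr_num g' a b c d / cr_den g' a b c d.
Proof.
move=> w0 Eg a b c d.
have -> : cr_num g a b c d = (w a * w b * w c * w d) * cr_num g' a b c d.
  by rewrite /cr_num !Eg; ring.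
have -> : cr_den g a b c d = (w a * w b * w c * w d) * cr_den g' a b c d.
  by rewrite /cr_den !Eg; ring.
by rewrite -mulf_div divff ?mul1r // !mulf_neq0.
Qed.

Lemma cross_ratio_h (R : realType) (p : R[i]) (a b c d : LTR) :
  p != 0 -> p != 1 ->
  cross_ratio (h p a) (h p b) (h p c) (h p d)
  = cr_num (br p) a b c d / cr_den (br p) a b c d.
Proof.
move=> p0 p1.
have p1' : 1 - p != 0 by rewrite subr_eq0 eq_sym.
pose w x := match x with lE => p^-1 | lF => (1 - p)^-1 | _ => 1 end.
have w0 x : w x != 0 by case: x; rewrite /= ?invr_eq0 ?oner_eq0.
have hw x : ((hcoord (h p x)).1 = w x * (coord p x).1) *
            ((hcoord (h p x)).2 = w x * (coord p x).2).
  by case: x; rewrite /= ?mul1r ?mulr1 ?mulVf // mulrC.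
rewrite -(cross_ratio_scale (g := fun x y => bracket (h p x) (h p y)) w0) // => x y.
by rewrite /bracket !hw /br; ring.
Qed.

(** The homography z |-> 1 / (1 - z) is given by the matrix [0 1; -1 1], of
determinant 1; it sends the coordinates of x to those of turn x up to the sign
w x. *)
Lemma cross_ratio_turn (F : fieldType) (p : F) (a b c d : LTR) :
  cr_num (br p) (turn a) (turn b) (turn c) (turn d) / cr_den (br p) (turn a) (turn b) (turn c) (turn d)
  = cr_num (br p) a b c d / cr_den (br p) a b c d.
Proof.
pose w x : F := match x with lC | lF => -1 | _ => 1 end.
apply: (cross_ratio_scale (g := fun x y => br p (turn x) (turn y)) (w := w)).
  by case; rewrite /= ?oppr_eq0 oner_eq0.
by case; case; rewrite /br /=; ring.
Qed.

(** The quadruples (A, B, C, F), (B, C, A, E), (C, A, B, D) are successive images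
under c. *)
Lemma norm_sub_Theta (R : realType) (p : R[i]) :
  p != 0 -> p != 1 -> 'N(<[turnp]>)%g \subset Theta p.
Proof.
move=> p0 p1; apply/subsetP => eta; rewrite norm_turnE inE /= !cross_ratio_h //.
move=> etaN; pose X a b c d :=
  cr_num (br p) (eta a) (eta b) (eta c) (eta d) / cr_den (br p) (eta a) (eta b) (eta c) (eta d).
have X_turn a b c d : X a b c d = X (turn a) (turn b) (turn c) (turn d).
  by rewrite /X; case/orP: etaN => [/commutes_turnP | /reverses_turnP] E;
     rewrite !E !cross_ratio_turn.
by apply/andP; split; apply/eqP; [apply: (X_turn lA lB lC lF) | apply: (X_turn lB lC lA lE)].
Qed.

(** * The polynomial equations and their specialization *)

(** The two equations of Theta with denominators cleared. *)
Definition locus (S : comNzRingType) (t : S) (eta : LTR -> LTR) : S * S :=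
  let N a b c d := cr_num (br t) (eta a) (eta b) (eta c) (eta d) in
  let D a b c d := cr_den (br t) (eta a) (eta b) (eta c) (eta d) in
  (N lA lB lC lF * D lB lC lA lE - N lB lC lA lE * D lA lB lC lF,
   N lB lC lA lE * D lC lA lB lD - N lC lA lB lD * D lB lC lA lE).

Lemma rmorph_locus (S T : comNzRingType) (f : {rmorphism S -> T}) (t : S) eta :
  (f (locus t eta).1 = (locus (f t) eta).1) * (f (locus t eta).2 = (locus (f t) eta).2).
Proof.
by rewrite /locus /= /cr_num /cr_den !rmorphB !rmorphM !rmorph_br.
Qed.

Definition assign (a b c d e f x : LTR) : LTR :=
  match x with lA => a | lB => b | lC => c | lD => d | lE => e | lF => f end.

(** Any integer at which the equations keep only the generic solutions would
serve; 2 makes the six points 0, 1, oo, 2, 1/2, -1, which are distinct. *)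
Lemma locus2_norm (eta : {perm LTR}) :
  locus (2%Z : int) eta = (0, 0) -> (eta \in 'N(<[turnp]>))%g.
Proof.
have check : forall a b c d e f,
    if uniq (map code [:: a; b; c; d; e; f]) then
      let eta := assign a b c d e f in
      if ((locus (2%Z : int) eta).1 == 0) && ((locus (2%Z : int) eta).2 == 0)
      then commutes_turn eta || reverses_turn eta else true
    else true.
  by apply: all6_letters; vm_compute.
case E: (locus _ _) => [d1 d2] [d1_0 d2_0].
have eta_uniq : uniq (map code [:: eta lA; eta lB; eta lC; eta lD; eta lE; eta lF]).
  by rewrite (map_inj_uniq code_inj) (map_inj_uniq (@perm_inj _ eta) letters)
             -(map_inj_uniq code_inj).
have := check (eta lA) (eta lB) (eta lC) (eta lD) (eta lE) (eta lF).
rewrite eta_uniq norm_turnE => check_eta.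
have : if ((locus (2%Z : int) eta).1 == 0) && ((locus (2%Z : int) eta).2 == 0)
       then commutes_turn eta || reverses_turn eta else true by exact: check_eta.
by rewrite E d1_0 d2_0.
Qed.

Lemma br2_neq0 (x y : LTR) : x != y -> br (2%Z : int) x y != 0.
Proof. by rewrite LTR_eqE; case: x; case: y. Qed.

Lemma avoid_roots (C : closedFieldType) (I : finType) (P : pred I) (F : I -> {poly C}) :
  (forall i, P i -> F i != 0) ->
  exists s : seq C, forall z, z \notin s -> forall i, P i -> (F i).[z] != 0.
Proof.
move=> F0.
have prodF0 : \prod_(i | P i) F i != 0 by apply/prodf_neq0.
have [s Es] := closed_field_poly_normal (\prod_(i | P i) F i).
exists s => z zs i Pi; apply: contraNneq zs => Fz.
rewrite -root_prod_XsubC -(rootZ _ _ (a := lead_coef (\prod_(i | P i) F i))) ?lead_coef_eq0 //.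
by rewrite -Es (bigD1 i) //= rootM; apply/orP; left; apply/rootP.
Qed.

(** Non-vanishing is tested in int, where it is decided by computation. *)
Lemma poly_neq0_at (C : numDomainType) (f : {poly C}) (a n : int) :
  f.[a%:~R] = n%:~R -> n != 0 -> f != 0.
Proof.
move=> fa; apply: contraNneq => f0.
by move: fa; rewrite f0 horner0 => /esym/eqP; rewrite intr_eq0.
Qed.

(** Cross-multiplying is legitimate because the brackets in the denominators pair
distinct letters, which the injective eta keeps distinct. *)
Lemma Theta_locus (R : realType) (p : R[i]) (eta : {perm LTR}) :
  p != 0 -> p != 1 -> (forall x y, x != y -> br p x y != 0) ->
  eta \in Theta p -> locus p eta = (0, 0).
Proof.
move=> p0 p1 brp; rewrite inE /= !cross_ratio_h // => /andP[].
have brp_eta x y : x != y -> br p (eta x) (eta y) != 0.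
  by move=> xy; rewrite brp // (inj_eq perm_inj).
have den0 a b c d : a != d -> b != c ->
    cr_den (br p) (eta a) (eta b) (eta c) (eta d) != 0.
  by move=> ad bc; rewrite mulf_neq0 ?brp_eta.
rewrite !eqr_div ?den0 ?LTR_eqE // => /eqP E1 /eqP E2.
by congr pair; apply/eqP; rewrite subr_eq0; apply/eqP.
Qed.

Theorem proposition3p1 (R : realType) :
  exists exceptions : seq R[i],
    forall p : R[i], admissible p -> p \notin exceptions ->
      Theta p = <<Theta_generators>>%g.
Proof.
(* One of the two equations that eta violates at 2, for eta outside the
   normaliser. *)
pose Q (eta : {perm LTR}) : {poly R[i]} :=
  if (locus (2%Z : int) eta).1 == 0 then (locus 'X eta).2 else (locus 'X eta).1.
have brE (z : R[i]) x y : (br 'X x y).[z] = br z x y.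
  by rewrite -[LHS]/(horner_eval z _) rmorph_br /= horner_evalE hornerX.
have locusE (z : R[i]) (eta : LTR -> LTR) :
    ((locus 'X eta).1.[z] = (locus z eta).1) * ((locus 'X eta).2.[z] = (locus z eta).2).
  by rewrite -![_.[z]]/(horner_eval z _) !rmorph_locus /= horner_evalE hornerX.
have [s1 br0] : exists s : seq R[i], forall z, z \notin s ->
    forall xy : LTR * LTR, xy.1 != xy.2 -> (br 'X xy.1 xy.2).[z] != 0.
  apply: avoid_roots => -[x y] /br2_neq0; apply: (@poly_neq0_at _ _ 2).
  by rewrite brE rmorph_br.
have [s2 Q0] : exists s : seq R[i], forall z, z \notin s ->
    forall eta, eta \notin 'N(<[turnp]>)%g -> (Q eta).[z] != 0.
  apply: avoid_roots => eta etaN; rewrite /Q; case: ifPn => [/eqP d1 | ].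
    apply: (@poly_neq0_at _ _ 2 (locus (2%Z : int) eta).2).
      by rewrite locusE rmorph_locus.
    apply: contraNneq etaN => d2; apply: locus2_norm.
    by move: d1 d2; case: (locus _ _) => d1 d2 /= -> ->.
  by apply: (@poly_neq0_at _ _ 2); rewrite locusE rmorph_locus.
exists (s1 ++ s2) => p /and4P[p0 p1 _ _].
rewrite mem_cat negb_or => /andP[/br0 brp /Q0 Qp].
have <- : 'N(<[turnp]>)%g = <<Theta_generators>>%g.
  by apply/eqP; rewrite eqEsubset norm_sub_generators generators_sub_norm.
apply/eqP; rewrite eqEsubset norm_sub_Theta // andbT.
apply/subsetP => eta etaT; apply: contraT => /Qp.
have etaL : locus p eta = (0, 0).
  by apply: Theta_locus => // x y xy; rewrite -brE (brp (x, y)).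
by rewrite /Q; case: ifP => _; rewrite locusE etaL eqxx.
Qed.
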